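(* Let $\vdash$ be a logic with a partition function $x\cdot y$ that is determined by a Hilbert-style calculus $\mathcal{H}$ with finite rules. Let $\mathcal{H}^{l}$ be the Hilbert-style calculus consisting of the following rules: (H1) $\emptyset\rhd\psi$ for every axiom $\emptyset\rhd\psi$ of $\mathcal{H}$; (H2) $\gamma_1,\dots,\gamma_n\rhd\varphi\cdot(\gamma_1\cdot(\gamma_2\cdot\ldots(\gamma_{n-1}\cdot\gamma_n)\ldots))$ for every rule $\gamma_1,\dots,\gamma_n\rhd\varphi$ of $\mathcal{H}$ with $n\ge1$; (H3) $x\rhd x\cdot y$; (H4) $\chi(\epsilon,\vec{z})\rhd\chi(\delta,\vec{z})$ and $\chi(\delta,\vec{z})\rhd\chi(\epsilon,\vec{z})$ for every formula $\chi(v,\vec{z})$ and every equation $\epsilon\approx\delta$ among the partition-function identities (P1)–(P5) (instantiated by the formula $x\cdot y$ and the basic operations). Then $\mathcal{H}^{l}$ is a complete Hilbert-style calculus for the left variable inclusion companion $\vdash^{l}$.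
   Context: Fix an algebraic language without constant symbols; $\mathrm{Var}(\varphi)$ is the set of variables of $\varphi$. A logic is a substitution-invariant consequence relation. A Hilbert-style calculus with finite rules is a (possibly infinite) set of Hilbert-style rules each with finitely many premises; the logic it determines is the derivability relation. The left variable inclusion companion: $\Gamma\vdash^{l}\varphi$ iff there is $\Gamma'\subseteq\Gamma$ with $\bigcup_{\gamma\in\Gamma'}\mathrm{Var}(\gamma)\subseteq\mathrm{Var}(\varphi)$ and $\Gamma'\vdash\varphi$. A matrix $\langle\mathbf{A},F\rangle$ is a model of $\vdash$ if $\Gamma\vdash\varphi$ and $h[\Gamma]\subseteq F$ (for homomorphisms $h$ from the formula algebra) imply $h(\varphi)\in F$. $\Omega^{\mathbf{A}}F$ is the largest congruence compatible with $F$; the Suszko congruence is the intersection of $\Omega^{\mathbf{A}}G$ over $\vdash$-filters $G\supseteq F$; $\mathrm{Alg}(\vdash)$ is the class of algebras with a model of identity Suszko congruence. The partition-function identities for a binary term $\cdot$ are, for all basic operations $g$ of arity $n\ge1$: (P1) $a\cdot a=a$; (P2) $a\cdot(b\cdot c)=(a\cdot b)\cdot c$; (P3) $a\cdot(b\cdot c)=a\cdot(c\cdot b)$; (P4) $g(a_1,\dots,a_n)\cdot b=g(a_1\cdot b,\dots,a_n\cdot b)$; (P5) $b\cdot g(a_1,\dots,a_n)=b\cdot a_1\cdot\ldots\cdot a_n$. A logic $\vdash$ has a partition function $x\cdot y$ if $x\cdot y$ is a formula in which both $x,y$ really occur, $x\vdash x\cdot y$, and the identities (P1)–(P5) hold for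 $\cdot^{\mathbf{A}}$ in every $\mathbf{A}\in\mathrm{Alg}(\vdash)$. *)

(* Defs.v *)
From Stdlib Require List.
From mathcomp Require Import all_boot.
From mathcomp Require Import boolp classical_sets.

Set Implicit Arguments.
Unset Strict Implicit.
Unset Printing Implicit Defensive.

Local Open Scope classical_set_scope.

Record language := Language {
  op :> Type;
  arity : op -> nat;
  arity_gt0 : forall f, 0 < arity f }.
Arguments arity {l} f.

Record algebra (Lg : language) := Algebra {
  carrier :> Type;
  algop : forall f : Lg, ('I_(arity f) -> carrier) -> carrier;
  carrier_inhabited : inhabited carrier }.
Arguments algop {Lg} a f args.

(* Formulas over the countably infinite set of variables [Var 0, Var 1, ...]. *)
Inductive form (Lg : language) : Type :=
| Var of nat
| App (f : Lg) of ('I_(arity f) -> form Lg).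
Arguments Var {Lg} n.
Arguments App {Lg} f args.

Fixpoint vars (Lg : language) (t : form Lg) : set nat :=
  match t with
  | Var x => [set x]
  | App f args => \bigcup_i vars (args i)
  end.

Definition Fm (Lg : language) : algebra Lg :=
  @Algebra Lg (form Lg) (fun f => App f) (inhabits (Var 0)).

Definition is_hom (Lg : language) (A B : algebra Lg) (h : A -> B) : Prop :=
  forall (f : Lg) (args : 'I_(arity f) -> A),
    h (algop A f args) = algop B f (h \o args).

(* The homomorphic extension to formulas of an assignment of the variables. *)
Fixpoint eval (Lg : language) (A : algebra Lg) (v : nat -> A) (t : form Lg) : A :=
  match t with
  | Var x => v x
  | App f args => algop A f (fun i => eval v (args i))
  end.

Lemma eval_hom (Lg : language) (A : algebra Lg) (v : nat -> A) :
  is_hom (A := Fm Lg) (eval v).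
Proof. by []. Qed.

Lemma hom_eval (Lg : language) (A : algebra Lg) (h : Fm Lg -> A) :
  is_hom h -> h = eval (fun x => h (Var x)).
Proof.
move=> hh; apply/funext; elim=> [//|f args IH] /=.
by rewrite [LHS]hh; congr algop; apply/funext => i /=.
Qed.

Definition subst (Lg : language) (s : nat -> form Lg) : form Lg -> form Lg :=
  eval (A := Fm Lg) s.

(* [repl v e chi] is the formula chi(e, z), where chi = chi(v, z). *)
Definition repl (Lg : language) (v : nat) (e : form Lg) : form Lg -> form Lg :=
  subst (fun x => if x == v then e else Var x).

Definition consequence (Lg : language) := set (form Lg) -> form Lg -> Prop.

Record is_logic (Lg : language) (L : consequence Lg) : Prop := IsLogic {
  logic_refl : forall (G : set (form Lg)) a, G a -> L G a;
  logic_cut : forall (G D : set (form Lg)) a,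
    (forall d, D d -> L G d) -> L D a -> L G a;
  logic_struct : forall (s : nat -> form Lg) (G : set (form Lg)) a,
    L G a -> L (subst s @` G) (subst s a) }.

(* A set of rules with finitely many premises: [H gs a] means that the rule
   with premises [gs] and conclusion [a] is in [H]. *)
Definition calculus (Lg : language) := seq (form Lg) -> form Lg -> Prop.

Inductive derivable (Lg : language) (H : calculus Lg) (G : set (form Lg)) :
    form Lg -> Prop :=
| der_hyp a : G a -> derivable H G a
| der_rule gs a (s : nat -> form Lg) :
    H gs a -> (forall g, List.In g gs -> derivable H G (subst s g)) ->
    derivable H G (subst s a).

Definition determines (Lg : language) (H : calculus Lg) (L : consequence Lg) :
    Prop :=
  forall (G : set (form Lg)) (a : form Lg), L G a <-> derivable H G a.

Definition left_companion (Lg : language) (L : consequence Lg) :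
    consequence Lg :=
  fun G a => exists G' : set (form Lg),
    [/\ G' `<=` G, \bigcup_(g in G') vars g `<=` vars a & L G' a].

Section Matrices.
Variables (Lg : language) (L : consequence Lg) (A : algebra Lg).

Definition congruence (R : A -> A -> Prop) : Prop :=
  [/\ forall a, R a a,
      forall a b, R a b -> R b a,
      forall a b c, R a b -> R b c -> R a c &
      forall (f : Lg) (u w : 'I_(arity f) -> A),
        (forall i, R (u i) (w i)) -> R (algop A f u) (algop A f w)].

Definition compatible (F : set A) (R : A -> A -> Prop) : Prop :=
  forall a b, R a b -> F a -> F b.

(* The union of the congruences compatible with [F]; by [leibniz_largest] it is
   itself the largest such congruence. *)
Definition leibniz (F : set A) (a b : A) : Prop :=
  exists R, [/\ congruence R, compatible F R & R a b].

Definition is_filter (F : set A) : Prop :=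
  forall (G : set (form Lg)) (a : form Lg), L G a ->
  forall h : Fm Lg -> A, is_hom h -> h @` G `<=` F -> F (h a).

Definition suszko (F : set A) (a b : A) : Prop :=
  forall G : set A, is_filter G -> F `<=` G -> leibniz G a b.

Definition in_Alg : Prop :=
  exists2 F : set A, is_filter F & forall a b, suszko F a b <-> a = b.

Definition validates (e d : form Lg) : Prop :=
  forall h : Fm Lg -> A, is_hom h -> h e = h d.

Inductive leibniz_path (F : set A) (a : A) : A -> Prop :=
| path_nil : leibniz_path F a a
| path_step b c : leibniz_path F a b -> leibniz F b c -> leibniz_path F a c.

Lemma leibniz_path_trans F a b c :
  leibniz_path F a b -> leibniz_path F b c -> leibniz_path F a c.
Proof. by move=> ab; elim=> // x y _ ax xy; apply: path_step xy. Qed.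

Lemma leibniz_sym F a b : leibniz F a b -> leibniz F b a.
Proof. by move=> [R [Rc RF ab]]; exists R; split=> //; case: Rc => _ + _ _; apply. Qed.

Lemma leibniz_path_congruence F : congruence (leibniz_path F).
Proof.
split=> [a|a b|a b c|f u w uw]; first exact: path_nil.
- elim=> [|x y _ xa xy]; first exact: path_nil.
  apply: leibniz_path_trans xa; apply: path_step (leibniz_sym xy).
  exact: path_nil.
- exact: leibniz_path_trans.
pose m k i := if (i : 'I_(arity f)) < k then w i else u i.
have step k : leibniz_path F (algop A f u) (algop A f (m k)).
  elim: k => [|k IH].
    by rewrite (_ : m 0 = u); [exact: path_nil | apply/funext].
  apply: leibniz_path_trans IH _.
  case: (ltnP k (arity f)) => [kn|nk]; last first.
    rewrite (_ : m k.+1 = m k); first exact: path_nil.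
    apply/funext => i; have ik := leq_trans (ltn_ord i) nk.
    by rewrite /m ik ltnS (ltnW ik).
  pose o := Ordinal kn.
  pose n x i := if i == o then x else m k i.
  have nk x : x = u o -> m k = n x.
    move=> ->; apply/funext => i; rewrite /n; case: eqP => // ->.
    by rewrite /m /= ltnn.
  have nk1 : m k.+1 = n (w o).
    apply/funext => i; rewrite /n; case: eqP => [->|/eqP ne].
      by rewrite /m /= leqnn.
    by rewrite /m ltnS leq_eqVlt -[_ == k]/(i == o) (negPf ne).
  rewrite (nk _ erefl) nk1; elim: (uw o) => [|x y _ IH xy]; first exact: path_nil.
  apply: path_step IH _; case: xy => R [Rc RF xy]; exists R; split=> //.
  case: Rc => Rr _ _ Rf; apply: Rf => i; rewrite /n.
  by case: eqP => // _; apply: Rr.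
suff -> : w = m (arity f) by exact: step.
by apply/funext => i; rewrite /m ltn_ord.
Qed.

Lemma leibniz_pathE F a b : leibniz F a b <-> leibniz_path F a b.
Proof.
split=> [ab|ab]; first exact: path_step (path_nil _ _) ab.
exists (leibniz_path F); split=> //; first exact: leibniz_path_congruence.
by move=> x y; elim=> // z t _ IH [R [_ RF zt]] Fx; exact: RF zt (IH Fx).
Qed.

Lemma leibniz_largest (F : set A) :
  [/\ congruence (leibniz F), compatible F (leibniz F) &
      forall R, congruence R -> compatible F R ->
        forall a b, R a b -> leibniz F a b].
Proof.
split; last by move=> R Rc RF a b ab; exists R.
  suff -> : leibniz F = leibniz_path F by exact: leibniz_path_congruence.
  by apply/funext => a; apply/funext => b; apply/propext; exact: leibniz_pathE.
by move=> a b [R [_ RF ab]]; exact: RF ab.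
Qed.

End Matrices.

(* [p] stands for the formula x.y, with x = [Var 0] and y = [Var 1];
   [dot p a b] is then a.b. *)
Definition dot (Lg : language) (p a b : form Lg) : form Lg :=
  subst (fun x => if x == 0 then a else b) p.

(* ((a.c1).c2). ... .cn *)
Definition ldots (Lg : language) (p a : form Lg) (cs : seq (form Lg)) :
    form Lg :=
  foldl (dot p) a cs.

(* c.(c1.(c2. ... (c(n-1).cn) ... )) *)
Fixpoint rdots (Lg : language) (p c : form Lg) (cs : seq (form Lg)) : form Lg :=
  if cs is c' :: cs' then dot p c (rdots p c' cs') else c.

Inductive pf_identity (Lg : language) (p : form Lg) :
    form Lg -> form Lg -> Prop :=
| P1 : pf_identity p (dot p (Var 0) (Var 0)) (Var 0)
| P2 : pf_identity p (dot p (Var 0) (dot p (Var 1) (Var 2)))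
                     (dot p (dot p (Var 0) (Var 1)) (Var 2))
| P3 : pf_identity p (dot p (Var 0) (dot p (Var 1) (Var 2)))
                     (dot p (Var 0) (dot p (Var 2) (Var 1)))
| P4 (g : Lg) :
    pf_identity p
      (dot p (App g (fun i => Var i)) (Var (arity g)))
      (App g (fun i => dot p (Var i) (Var (arity g))))
| P5 (g : Lg) :
    pf_identity p
      (dot p (Var (arity g)) (App g (fun i => Var i)))
      (ldots p (Var (arity g)) [seq Var i | i <- iota 0 (arity g)]).

Record partition_function (Lg : language) (L : consequence Lg) (p : form Lg) :
    Prop := PartitionFunction {
  pf_vars : vars p = [set 0; 1];
  pf_infer : L [set Var 0] p;
  pf_identities : forall A : algebra Lg, in_Alg L A ->
    forall e d, pf_identity p e d -> validates A e d }.

Inductive left_calculus (Lg : language) (p : form Lg) (H : calculus Lg) :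
    calculus Lg :=
| H1 a : H [::] a -> left_calculus p H [::] a
| H2 g gs a : H (g :: gs) a ->
    left_calculus p H (g :: gs) (dot p a (rdots p g gs))
| H3 : left_calculus p H [:: Var 0] p
| H4l (chi : form Lg) (v : nat) e d : pf_identity p e d ->
    left_calculus p H [:: repl v e chi] (repl v d chi)
| H4r (chi : form Lg) (v : nat) e d : pf_identity p e d ->
    left_calculus p H [:: repl v d chi] (repl v e chi).

(* Main.v *)
(** Soundness of (H4) holds because the quotient of the formula algebra by the
    intersection of the Leibniz congruences of all theories belongs to
    [in_Alg L]: both sides of a partition-function identity are therefore
    identified by the Leibniz congruence of every theory.

    For completeness, let [c] be derivable in [H] from premises whose variables
    all occur in [c]. Projecting the variables outside [c] to one inside [c]
    (which exists as there are no constants), we may assume that the whole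
    derivation uses variables of [c] only. Then every formula [t] in it is
    replaced by [t.c]: an instance of a rule of [H] under [s] becomes the
    instance of the corresponding rule (H2) under [x |-> s x . c], since
    [t(x.c) = t.c] by (P4) and [(t.c).u = t.c] by (P1)-(P3) and (P5) as soon as
    the variables of [u] occur in [c]. At the end, [c.c = c]. *)
Require Import Defs.
From Stdlib Require List.
From mathcomp Require Import all_boot.
From mathcomp Require Import boolp classical_sets.

Set Implicit Arguments.
Unset Strict Implicit.
Unset Printing Implicit Defensive.

Local Open Scope classical_set_scope.

(** * Substitutions and variables *)

Lemma subst_comp (Lg : language) (s r : nat -> form Lg) (t : form Lg) :
  subst s (subst r t) = subst (fun x => subst s (r x)) t.
Proof. by elim: t => //= f args IH; congr App; apply/funext => i; apply: IH. Qed.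

Lemma subst_eq (Lg : language) (s r : nat -> form Lg) (t : form Lg) :
  (forall x, vars t x -> s x = r x) -> subst s t = subst r t.
Proof.
elim: t => [x|f args IH] /= sr; first exact: sr.
by congr App; apply/funext => i; apply: IH => x tx; apply: sr; exists i.
Qed.

Lemma subst_Var (Lg : language) (t : form Lg) : subst Var t = t.
Proof. by elim: t => //= f args IH; congr App; apply/funext => i; apply: IH. Qed.

Lemma vars_subst (Lg : language) (s : nat -> form Lg) (t : form Lg) :
  vars (subst s t) = \bigcup_(x in vars t) vars (s x).
Proof.
elim: t => [x|f args IH] /=; first by rewrite bigcup_set1.
rewrite bigcup_bigcup; apply: eq_bigcupr => i _; exact: IH.
Qed.

Lemma vars_neq0 (Lg : language) (t : form Lg) : exists x, vars t x.
Proof.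
elim: t => [x|f args IH] /=; first by exists x.
by have [x xi] := IH (Ordinal (arity_gt0 f)); exists x; exists (Ordinal (arity_gt0 f)).
Qed.

Lemma vars_bounded (Lg : language) (t : form Lg) :
  exists n, forall x, vars t x -> x < n.
Proof.
elim: t => [x|f args /choice[b bP]] /=; first by exists x.+1 => y ->.
exists (\max_i b i) => x [i _ /bP xi]; exact: leq_trans xi (leq_bigmax i).
Qed.

Lemma subst_dot (Lg : language) (s : nat -> form Lg) (p a b : form Lg) :
  subst s (dot p a b) = dot p (subst s a) (subst s b).
Proof. by rewrite subst_comp; congr subst; apply/funext => x; case: ifP. Qed.

Lemma subst_rdots (Lg : language) (s : nat -> form Lg) (p c : form Lg) cs :
  subst s (rdots p c cs) = rdots p (subst s c) [seq subst s d | d <- cs].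
Proof. by elim: cs c => [//|d cs IH] c /=; rewrite subst_dot IH. Qed.

Lemma subst_ldots (Lg : language) (s : nat -> form Lg) (p c : form Lg) cs :
  subst s (ldots p c cs) = ldots p (subst s c) [seq subst s d | d <- cs].
Proof. by elim: cs c => [//|d cs IH] c /=; rewrite IH subst_dot. Qed.

Section VarsDot.
Variables (Lg : language) (p : form Lg).
Hypothesis vp : vars p = [set 0; 1].

Lemma vars_dot a b : vars (dot p a b) = vars a `|` vars b.
Proof. by rewrite vars_subst vp bigcup_setU !bigcup_set1. Qed.

Lemma vars_ldots a cs x :
  vars (ldots p a cs) x <-> vars a x \/ exists2 c, List.In c cs & vars c x.
Proof.
elim: cs a => [|c cs IH] a /=; first by split=> [|[|[]]] //; left.
rewrite IH vars_dot; split.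
- move=> [[ax|cx]|[d dcs dx]]; [by left|by right; exists c => //; left|].
  by right; exists d => //; right.
- move=> [ax|[d [<-|dcs] dx]]; [by left; left|by left; right|].
  by right; exists d.
Qed.

Lemma vars_rdots a cs x :
  vars (rdots p a cs) x <-> exists2 c, List.In c (a :: cs) & vars c x.
Proof.
elim: cs a => [|c cs IH] a.
  by split=> /= [ax|[c [<-|[]]]] //; exists a => //; left.
rewrite /= vars_dot; split.
- by move=> [ax|/IH[d dc dx]]; [exists a => //; left|exists d => //; right].
- by move=> [d [<-|dc] dx]; [left|right; apply/IH; exists d].
Qed.

(** Since both sides have the same variables, an instance of (H4) has premise and conclusion with
    equal variable sets, as variable inclusion requires. *)
Lemma vars_pf_identity e d : pf_identity p e d -> vars e = vars d.
Proof.
case=> [||| g|g]; rewrite ?vars_dot.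
- exact: setUid.
- exact: setUA.
- by rewrite [X in _ `|` X]setUC.
- rewrite /=; apply/seteqP; split=> x.
  + move=> [[i _ ix]|xg]; first by exists i => //; rewrite vars_dot; left.
    (* Positive arity provides an argument of [g] in which the right factor occurs. *)
    by exists (Ordinal (arity_gt0 g)) => //; rewrite vars_dot; right.
  + by move=> [i _]; rewrite vars_dot => -[ix|ix]; [left; exists i|right].
- rewrite /=; apply/seteqP; split=> x.
  + move=> [gx|[i _ ix]]; apply/vars_ldots; [by left|right].
    exists (Var i) => //; apply: List.in_map; apply/List.in_seq => /=.
    by split; apply/leP => //; apply: ltn_ord.
  + move=> /vars_ldots[gx|[c /List.in_map_iff[i [<- /List.in_seq[_ /ltP ig]]]]].
      by left.
    by move=> ix; right; exists (Ordinal ig).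
Qed.

End VarsDot.

(** * Congruences of the formula algebra *)

Lemma congruence_subst (Lg : language) (R : form Lg -> form Lg -> Prop)
    (s r : nat -> form Lg) (t : form Lg) :
  congruence (A := Fm Lg) R -> (forall x, R (s x) (r x)) ->
  R (subst s t) (subst r t).
Proof. by move=> [_ _ _ RA] sr; elim: t => //= f args IH; apply: RA. Qed.

Section IdentitiesOfAlg.
Variables (Lg : language) (L : consequence Lg).
Hypothesis logL : is_logic L.

Lemma logic_mono (G D : set (form Lg)) a : D `<=` G -> L D a -> L G a.
Proof. by move=> DG; apply: (logic_cut logL) => d /DG; apply: logic_refl. Qed.

Lemma theory_filter (D : set (form Lg)) : is_filter (A := Fm Lg) L (L D).
Proof.
move=> G a La h /hom_eval -> GD.
by apply: (logic_cut logL) (logic_struct logL _ La) => d /GD.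
Qed.

(** Every filter contains [set0], so this is the intersection of the Leibniz congruences of all
    [L]-filters on the formula algebra. *)
Let R := suszko (A := Fm Lg) L set0.

Let RE (t u : Fm Lg) : R t u <->
  forall G : set (Fm Lg), is_filter L G -> leibniz G t u.
Proof. by split=> [tu G GF|tu G GF _]; apply: tu. Qed.

Let R_congruence : congruence R.
Proof.
split=> [a|a b|a b c|f u w uw].
- by move=> G _ _; have [[+ _ _ _] _ _] := leibniz_largest G; apply.
- by move=> ab G GF G0; apply: leibniz_sym; apply: ab.
- move=> ab bc G GF G0; have [[_ _ + _] _ _] := leibniz_largest G.
  by apply; [apply: ab|apply: bc].
- move=> G GF G0; have [[_ _ _ +] _ _] := leibniz_largest G.
  by apply=> i; apply: uw.
Qed.

Let R_compatible (G : set (Fm Lg)) : is_filter L G -> compatible G R.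
Proof. by move=> GF a b /RE/(_ G GF); have [_ + _] := leibniz_largest G; apply. Qed.

(** Elements of the quotient are the classes of [R], as sets of formulas; [rep] chooses
    representatives, on which the operations of [A] are computed. *)
Let Q := {S : set (form Lg) | exists t, S = R t}.

Let pi (t : form Lg) : Q := exist _ (R t) (ex_intro _ t erefl).

Let rep (a : Q) : form Lg := projT1 (cid (proj2_sig a)).

Let piE t u : R t u -> pi t = pi u.
Proof.
move=> tu; apply: eq_exist; apply/funext => x; apply/propext.
by have [_ Rs Rt _] := R_congruence; split; apply: Rt => //; apply: Rs.
Qed.

Let piI t u : pi t = pi u -> R t u.
Proof. by move=> [->]; have [Rr _ _ _] := R_congruence; apply: Rr. Qed.

Let repK a : pi (rep a) = a.
Proof.
by case: a => S SE; apply: eq_exist; rewrite /rep; case: cid => t /= ->.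
Qed.

Let A : algebra Lg :=
  @Algebra Lg Q (fun f args => pi (App f (rep \o args))) (inhabits (pi (Var 0))).

Let pi_hom : is_hom (A := Fm Lg) (B := A) pi.
Proof.
move=> f args; apply: piE; have [_ _ _ RA] := R_congruence.
by apply: RA => i /=; apply: piI; rewrite repK.
Qed.

Let rep_compat (G : set (Fm Lg)) t : is_filter L G -> G (rep (pi t)) <-> G t.
Proof.
by move=> GF; split; apply: R_compatible => //; apply: piI; rewrite repK.
Qed.

(** Choosing representatives of the values [h (Var x)] lifts [h] to a substitution followed by [pi];
    compatibility of [R] with [G] makes the choice harmless. *)
Let filter_quot (G : set (Fm Lg)) :
  is_filter L G -> is_filter (A := A) L [set a | G (rep a)].
Proof.
move=> GF D t Dt h hh hD.
have hE u : h u = pi (subst (fun x => rep (h (Var x))) u).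
  elim: u => [x|f args IH] /=; first by rewrite repK.
  apply: etrans (hh f args) _; apply: etrans (esym (pi_hom _)).
  by congr (algop A f _); apply/funext => i /=; exact: IH.
rewrite /= hE; apply/(rep_compat _ GF).
apply: (GF _ _ Dt _ (eval_hom _)) => _ [u Du <-].
by apply/(rep_compat _ GF); rewrite -hE; apply: hD; exists u.
Qed.

Let A_in_Alg : in_Alg L A.
Proof.
(* The classes of theorems form a filter below the quotient of every filter of the formula
   algebra. *)
exists [set a | L set0 (rep a)]; first by apply: filter_quot; apply: theory_filter.
move=> a b; split=> [ab|<- G _ _]; last first.
  by have [[+ _ _ _] _ _] := leibniz_largest G; apply.
rewrite -(repK a) -(repK b); apply: piE; apply/RE => G GF.
have FG : [set a | L set0 (rep a)] `<=` [set a : A | G (rep a)].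
  move=> c Lc; rewrite /= -[rep c]subst_Var.
  by apply: (GF _ _ Lc _ (eval_hom _)) => _ [u []].
have [S [Sc SG Sab]] := ab _ (filter_quot GF) FG.
(* A congruence of the quotient compatible with the image of [G] pulls back along [pi] to one
   compatible with [G]. *)
exists (fun t u => S (pi t) (pi u)); split; last by rewrite !repK.
- case: Sc => Sr Ss St SA; split=> [t|t u|t u v|f u w uw].
  + exact: Sr.
  + exact: Ss.
  + exact: St.
  + by rewrite !pi_hom; apply: SA.
- by move=> t u tu /(rep_compat _ GF) Gt; apply/(rep_compat _ GF); apply: SG tu Gt.
Qed.

Lemma leibniz_identity e d (G : set (Fm Lg)) :
  (forall A : algebra Lg, in_Alg L A -> validates A e d) ->
  is_filter L G -> leibniz G e d.
Proof. by move=> /(_ A A_in_Alg pi pi_hom)/piI/RE; apply. Qed.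

(** The theory generated by the premise is a filter; its Leibniz congruence relates [e] to [d],
    hence the two instances of [chi], and it is compatible with that theory. *)
Lemma logic_repl e d chi v :
  (forall G : set (Fm Lg), is_filter L G -> leibniz G e d) ->
  L [set repl v e chi] (repl v d chi).
Proof.
move=> ed; set G := L _; have GF : is_filter (A := Fm Lg) L G by exact: theory_filter.
have [Gc Gcomp _] := leibniz_largest (A := Fm Lg) G.
apply: (Gcomp (repl v e chi)); last exact: (logic_refl logL).
apply: (congruence_subst _ Gc) => x; case: eqP => _; first exact: ed.
by have [+ _ _ _] := Gc; apply.
Qed.

End IdentitiesOfAlg.

(** * Soundness *)

Section Soundness.
Variables (Lg : language) (L : consequence Lg) (p : form Lg) (H : calculus Lg).
Hypotheses (logL : is_logic L) (pfp : partition_function L p).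
Hypothesis detL : determines H L.

Lemma companion_rule (G : set (form Lg)) gs a (s : nat -> form Lg) :
  (forall g, List.In g gs -> vars g `<=` vars a) ->
  L [set g | List.In g gs] a ->
  (forall g, List.In g gs -> left_companion L G (subst s g)) ->
  left_companion L G (subst s a).
Proof.
move=> va La IH.
(* The witness collects every member of [G] whose variables lie in a single premise instance; it
   includes the witnesses of all the premises. *)
exists (\bigcup_(g in [set g | List.In g gs])
  [set b | G b /\ vars b `<=` vars (subst s g)]); split.
- by move=> b [g _ [Gb _]].
- move=> x [b [g gin [_ bg]] /bg]; rewrite !vars_subst => -[y gy xy].
  by exists y => //; apply: va gy.
- apply: (logic_cut logL) (logic_struct logL s La) => _ [g gin <-].
  have [D [DG vD LD]] := IH g gin; apply: (logic_mono logL) LD => b Db.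
  by exists g => //; split; [apply: DG|move=> x bx; apply: vD; exists b].
Qed.

Lemma calculus_rule_logic gs a : H gs a -> L [set g | List.In g gs] a.
Proof.
move=> Ha; apply/detL; rewrite -[a]subst_Var.
by apply: (der_rule (s := Var) Ha) => g gin; rewrite subst_Var; apply: der_hyp.
Qed.

Lemma logic_dot a b : L [set a] (dot p a b).
Proof.
have := logic_struct logL (fun x => if x == 0 then a else b) (pf_infer pfp).
by rewrite image_set1.
Qed.

Lemma vars_repl (e d : form Lg) v chi :
  vars e = vars d -> vars (repl v e chi) = vars (repl v d chi).
Proof.
by move=> ed; rewrite !vars_subst; apply: eq_bigcupr => x _; case: ifP.
Qed.

Lemma left_calculus_vars gs a : left_calculus p H gs a ->
  forall g, List.In g gs -> vars g `<=` vars a.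
Proof.
case=> [b _ g []|g gs' b _ h hin||chi v e d ed g|chi v e d ed g].
- rewrite (vars_dot (pf_vars pfp)) => x hx; right.
  by apply/(vars_rdots (pf_vars pfp)); exists h.
- by move=> g [<-|[]] x /= ->; rewrite (pf_vars pfp); left.
- by move=> [<-|[]]; rewrite (vars_repl _ _ (vars_pf_identity (pf_vars pfp) ed)).
- by move=> [<-|[]]; rewrite (vars_repl _ _ (vars_pf_identity (pf_vars pfp) ed)).
Qed.

Lemma left_calculus_logic gs a : left_calculus p H gs a ->
  L [set g | List.In g gs] a.
Proof.
have sub1 (b c : form Lg) : L [set b] c -> L [set g | List.In g [:: b]] c.
  by apply: (logic_mono logL) => _ ->; left.
have idL e d : pf_identity p e d -> forall G : set (Fm Lg),
    is_filter L G -> leibniz G e d.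
  by move=> ed G; apply: leibniz_identity => // A /(pf_identities pfp); apply.
case=> [b /calculus_rule_logic//|g gs' b Hb||chi v e d ed|chi v e d ed].
(* (H2) is the original rule followed by an instance of [x |- x.y]. *)
- apply: (logic_cut logL) (logic_dot b _) => _ ->; exact: calculus_rule_logic.
- exact/sub1/(pf_infer pfp).
- by apply/sub1/(logic_repl logL) => G GF; apply: idL.
- by apply/sub1/(logic_repl logL) => G GF; apply: leibniz_sym; apply: idL.
Qed.

Lemma left_calculus_sound (G : set (form Lg)) a :
  derivable (left_calculus p H) G a -> left_companion L G a.
Proof.
elim=> [b Gb|gs b s Hb _ IH].
  exists [set b]; split=> [_ -> //||]; first by rewrite bigcup_set1.
  exact: (logic_refl logL).
apply: companion_rule IH; first exact: left_calculus_vars.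
exact: left_calculus_logic.
Qed.

End Soundness.

(** * The equational theory of (H4) *)

Inductive context (Lg : language) : (form Lg -> form Lg) -> Prop :=
| ctx_hole : context id
| ctx_app (f : Lg) (args : 'I_(arity f) -> form Lg) i K : context K ->
    context (fun t => App f (fun j => if j == i then K t else args j)).

Lemma context_comp (Lg : language) (K K' : form Lg -> form Lg) :
  context K -> context K' -> context (K \o K').
Proof. by move=> + cK'; elim=> [//|f args i K0 _ IH]; apply: (ctx_app _ _ IH). Qed.

(* Shifting the variables of the context beyond [N] makes room for the variables
   of [e] and for the hole. *)
Lemma context_repl (Lg : language) (K : form Lg -> form Lg) (s : nat -> form Lg) N :
  context K -> exists chi r, forall e, (forall x, vars e x -> x < N) ->
    K (subst s e) = subst r (repl N e chi).
Proof.
move=> cK.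
(* Variable [N] is the hole, those below it carry [s], and those above it undo the shift by [N.+1].
   The value at [N] itself never matters, as [repl] removes [N]. *)
pose r x := if x < N then s x else Var (x - N.+1).
suff [chi chiP] : exists chi, forall e, (forall x, vars e x -> x < N) ->
    K (subst s e) = subst r (repl N e chi) by exists chi, r.
elim: cK => [|f args i K0 _ [chi chiP]].
  exists (Var N) => e eN; rewrite (_ : repl N e (Var N) = e); last by rewrite /repl /subst /= eqxx.
  by apply: subst_eq => x /eN xN; rewrite /r xN.
pose shift := subst (fun k => @Var Lg (k + N.+1)).
exists (App f (fun j => if j == i then chi else shift (args j))) => e eN /=.
congr App; apply/funext => j; case: eqP => _; first exact: chiP.
suff shiftK u : subst r (repl N e (shift u)) = u by exact/esym/shiftK.
rewrite !subst_comp -[RHS]subst_Var; congr subst; apply/funext => k.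
have Nk : N < k + N.+1 by rewrite addnS ltnS leq_addl.
by rewrite /subst /= gtn_eqF//= /r ltnNge (ltnW Nk) addnK.
Qed.

Section Indiscernible.
Variables (Lg : language) (F : set (form Lg)).

(** This is the Leibniz congruence of [F] on formulas, described through one-hole contexts, a form
    in which (H4) applies directly. *)
Definition indiscernible (t u : form Lg) : Prop :=
  forall K, context K -> F (K t) <-> F (K u).

Lemma indiscernible_congruence : congruence (A := Fm Lg) indiscernible.
Proof.
have Rr t : indiscernible t t by [].
have Rt t u v : indiscernible t u -> indiscernible u v -> indiscernible t v.
  by move=> tu uv K cK; rewrite tu// uv.
split=> //; first by move=> t u tu K cK; rewrite tu.
move=> f u w uw /=.
(* The hybrid [m k] takes its first [k] arguments from [w]. Consecutive hybrids differ at most at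
   position [k], so a context with its hole there compares them. *)
pose m k (i : 'I_(arity f)) := if i < k then w i else u i.
suff step k : indiscernible (App f u) (App f (m k)).
  suff -> : w = m (arity f) by [].
  by apply/funext => i; rewrite /m ltn_ord.
elim: k => [|k IH]; first by rewrite (_ : m 0 = u)//; apply/funext.
apply: Rt IH _.
have [kn|nk] := ltnP k (arity f); last first.
  suff -> : m k.+1 = m k by [].
  by apply/funext => i; have ik := leq_trans (ltn_ord i) nk; rewrite /m ik ltnS ltnW.
pose o := Ordinal kn.
pose n x i := if i == o then x else m k i.
have -> : m k = n (u o).
  by apply/funext => i; rewrite /n; case: eqP => // ->; rewrite /m /= ltnn.
have -> : m k.+1 = n (w o).
  apply/funext => i; rewrite /n; case: eqP => [->|/eqP ne]; first by rewrite /m /= leqnn.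
  by rewrite /m ltnS leq_eqVlt -[_ == k]/(i == o) (negPf ne).
move=> K cK; exact: (uw o _ (context_comp cK (ctx_app (m k) o (ctx_hole Lg)))).
Qed.

End Indiscernible.

(** * Absorption laws modulo a congruence satisfying (P1)-(P5) *)

Section PartitionTheory.
Variables (Lg : language) (p : form Lg) (R : form Lg -> form Lg -> Prop).
Hypothesis Rc : congruence (A := Fm Lg) R.
Hypothesis Rid : forall e d s, pf_identity p e d -> R (subst s e) (subst s d).

Let Rr t : R t t. Proof. by case: Rc. Qed.
Let Rs t u : R t u -> R u t. Proof. by case: Rc => _ + _ _; apply. Qed.
Let Rt t u v : R t u -> R u v -> R t v. Proof. by case: Rc => _ _ + _; apply. Qed.
Let RA (f : Lg) u w : (forall i, R (u i) (w i)) -> R (App f u) (App f w).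
Proof. by case: Rc => _ _ _; apply. Qed.

Local Notation "a ** b" := (dot p a b) (at level 40, left associativity).

Lemma dot_cong a a' b b' : R a a' -> R b b' -> R (a ** b) (a' ** b').
Proof. by move=> aa bb; apply: congruence_subst => // x; case: ifP. Qed.

Lemma dotxx a : R (a ** a) a.
Proof. by have := Rid (fun=> a) (P1 p); rewrite subst_dot. Qed.

Lemma dotA a b c : R (a ** (b ** c)) (a ** b ** c).
Proof. by have := Rid (nth a [:: a; b; c]) (P2 p); rewrite !subst_dot. Qed.

Lemma dotCr a b c : R (a ** (b ** c)) (a ** (c ** b)).
Proof. by have := Rid (nth a [:: a; b; c]) (P3 p); rewrite !subst_dot. Qed.

Lemma dotAC a b c : R (a ** b ** c) (a ** c ** b).
Proof. exact: Rt (Rt (Rs (dotA a b c)) (dotCr a b c)) (dotA a c b). Qed.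

(** In (P4) and (P5) the arguments of [g] are the variables below [arity g] and the extra factor is
    [Var (arity g)], which receives the default [b]. *)
Let assign (g : Lg) (u : 'I_(arity g) -> form Lg) b x : form Lg :=
  if insub x is Some i then u i else b.

Let assign_ord g u b (i : 'I_(arity g)) : assign u b i = u i.
Proof. by rewrite /assign valK. Qed.

Let assign_max g (u : 'I_(arity g) -> form Lg) b : assign u b (arity g) = b.
Proof. by rewrite /assign insubF// ltnn. Qed.

Lemma app_dot g u b : R (App g u ** b) (App g (fun i => u i ** b)).
Proof.
have := Rid (assign u b) (P4 p g); rewrite subst_dot /subst /= assign_max.
rewrite (_ : (fun i => assign u b (val i)) = u); last first.
  by apply/funext => i; exact: assign_ord.
congr (R _ (App g _)); apply/funext => i.
rewrite -[LHS]/(subst (assign u b) (dot p (Var i) (Var (arity g)))) subst_dot.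
by rewrite /subst /= assign_ord assign_max.
Qed.

Lemma dot_app g u b : R (b ** App g u) (ldots p b [seq u i | i <- enum 'I_(arity g)]).
Proof.
have := Rid (assign u b) (P5 p g); rewrite subst_dot subst_ldots /subst /= assign_max.
rewrite (_ : (fun i => assign u b (val i)) = u); last first.
  by apply/funext => i; exact: assign_ord.
rewrite -val_enum_ord -!map_comp; congr (R _ (ldots p b _)).
by apply: eq_map => i /=; exact: assign_ord.
Qed.

(** By (P4), right multiplication by [b] commutes with all operations modulo [R]. *)
Lemma subst_dotr (s : nat -> form Lg) b t :
  R (subst (fun x => s x ** b) t) (subst s t ** b).
Proof.
by elim: t => [//|f args IH] /=; apply: Rt (Rs (app_dot _ _)); apply: RA.
Qed.

Lemma ldots_cong a a' cs : R a a' -> R (ldots p a cs) (ldots p a' cs).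
Proof. by elim: cs a a' => //= c cs IH a a' aa; apply/IH/dot_cong. Qed.

Lemma ldots_dot a cs b : R (ldots p a cs ** b) (ldots p (a ** b) cs).
Proof.
elim: cs a => [//|c cs IH] a /=; apply: Rt (IH _) _.
by apply: ldots_cong; apply: dotAC.
Qed.

(** Right factors commute, so [b] can be moved left until it stands next to [c], which absorbs
    it. *)
Lemma ldots_absorb a cs c b : List.In c cs ->
  (forall d, R (d ** c ** b) (d ** c)) -> R (ldots p a cs ** b) (ldots p a cs).
Proof.
move=> + cb; elim: cs a => [//|c' cs IH] a /= [->|]; last exact: IH.
by apply: Rt (ldots_dot _ _ _) _; apply: ldots_cong.
Qed.

(** (P5) unfolds the factor [t] into its arguments, one of which contains [x] and absorbs it by
    induction; at a variable this is idempotence. *)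
Lemma dot_absorb_var a t x : vars t x -> R (a ** t ** Var x) (a ** t).
Proof.
elim: t a => [y|f args IH] a /= => [->|[i _ xi]].
  by apply: Rt (Rs (dotA _ _ _)) _; apply: dot_cong => //; apply: dotxx.
apply: Rt (dot_cong (dot_app _ _) (Rr _)) _; apply: Rt (Rs (dot_app _ _)).
apply: (@ldots_absorb _ _ (args i)) => [|d]; last exact: IH.
elim: (enum _) (mem_enum 'I_(arity f) i) => //= j js IHj.
by rewrite inE; case: eqP => [-> _|_ /IHj]; [left|right].
Qed.

(** (P5) splits the factor [u] into its arguments, which are absorbed one after the other. *)
Lemma dot_absorb a t u : vars u `<=` vars t -> R (a ** t ** u) (a ** t).
Proof.
elim: u => [x|f args IH] /= ut; first by apply: dot_absorb_var; apply: ut.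
apply: Rt (dot_app _ _) _.
elim: (enum _) => [//|i js IHj] /=; apply: Rt (ldots_cong _ _) IHj.
by apply: IH => x xi; apply: ut; exists i.
Qed.

Lemma dot_absorb_rdots a t c cs :
  (forall u, List.In u (c :: cs) -> vars u `<=` vars t) ->
  R (a ** t ** rdots p c cs) (a ** t).
Proof.
elim: cs c => [|d cs IH] c ct /=; first by apply/dot_absorb/ct; left.
apply: Rt (dotA _ _ _) _.
apply: Rt (dot_cong _ (Rr _)) (IH d _); first by apply/dot_absorb/ct; left.
by move=> u ud; apply: ct; right.
Qed.

End PartitionTheory.

(** * Completeness *)

Section Completeness.
Variables (Lg : language) (p : form Lg) (H : calculus Lg) (G : set (form Lg)).

Let Hl := left_calculus p H.
Let R := indiscernible (derivable Hl G).

Lemma left_calculus_identity e d (s : nat -> form Lg) :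
  pf_identity p e d -> R (subst s e) (subst s d).
Proof.
move=> ed K cK.
have [[n en] [m dm]] := (vars_bounded e, vars_bounded d).
(* A common bound for the variables of [e] and [d] lets one [chi] serve both sides. *)
have [chi [r KE]] := context_repl s (maxn n m) cK.
rewrite !KE; first last.
- by move=> x /en xn; rewrite leq_max xn.
- by move=> x /dm xm; rewrite leq_max xm orbT.
split=> der.
- by apply: (der_rule (s := r) (H4l H chi _ ed)) => g [<-|[]].
- by apply: (der_rule (s := r) (H4r H chi _ ed)) => g [<-|[]].
Qed.

Let Rc : congruence (A := Fm Lg) R := indiscernible_congruence _.
Let Rid := left_calculus_identity.
Let Rt t u v : R t u -> R u v -> R t v. Proof. by case: Rc => _ _ + _; apply. Qed.

Lemma derivable_indiscernible t u : R t u -> derivable Hl G t <-> derivable Hl G u.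
Proof. by move/(_ id); apply; apply: ctx_hole. Qed.

Lemma derivable_dot a b : derivable Hl G a -> derivable Hl G (dot p a b).
Proof.
by move=> Ga; apply: (der_rule (s := fun x => if x == 0 then a else b) (H3 p H)) => g [<-|[]].
Qed.

Hypothesis vp : vars p = [set 0; 1].

Lemma left_calculus_simulates (D : set (form Lg)) c (pr : nat -> form Lg) t :
  D `<=` G -> (forall d, D d -> subst pr d = d) ->
  (forall x, vars (pr x) `<=` vars c) ->
  derivable H D t -> derivable Hl G (dot p (subst pr t) c).
Proof.
move=> DG prD prc; elim=> [b Db|gs b s Hb _ IH].
  (* Premises are fixed by [pr], and (H3) multiplies them by [c]. *)
  by rewrite prD//; apply: derivable_dot; apply: der_hyp; apply: DG.
pose r x := dot p (subst pr (s x)) c.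
have rE u : R (subst r u) (dot p (subst pr (subst s u)) c).
  by rewrite subst_comp; apply: subst_dotr.
have rc u : vars (subst r u) `<=` vars c.
  rewrite vars_subst => x [y _]; rewrite vars_dot// => -[|//].
  by rewrite vars_subst => -[z _ /prc].
have {}IH g : List.In g gs -> derivable Hl G (subst r g).
  by move=> /IH/(derivable_indiscernible (rE g)).
apply/(derivable_indiscernible (rE b)).
case: gs Hb IH => [|g gs] Hb IH; first exact: (der_rule (s := r) (H1 p Hb)).
have := der_rule (s := r) (H2 p Hb) IH; rewrite subst_dot subst_rdots.
apply: (iffLR (derivable_indiscernible _)).
(* The conclusion of (H2) becomes [t.c] times a product whose variables all lie in [c], and [c]
   absorbs that product. *)
apply: Rt (dot_cong p Rc (rE b) _) _; first by case: Rc => + _ _ _; apply.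
apply: Rt (dot_absorb_rdots Rc Rid _ _) _; last by case: Rc => _ + _ _; apply.
by move=> u [<-|/List.in_map_iff[v [<- _]]]; apply: rc.
Qed.

Lemma left_calculus_complete a : left_companion (derivable H) G a -> derivable Hl G a.
Proof.
move=> [D [DG vD Da]]; have [x0 ax0] := vars_neq0 a.
pose pr x : form Lg := if `[< vars a x >] then Var x else Var x0.
have prE t : vars t `<=` vars a -> subst pr t = t.
  move=> ta; rewrite -[RHS]subst_Var; apply: subst_eq => x /ta ax.
  by rewrite /pr asboolT.
have := @left_calculus_simulates D a pr a DG; rewrite prE// => /(_ _ _ Da) der.
(* The simulation is run with [c := a] and yields [a.a], which (P1) turns into [a]. *)
apply/(derivable_indiscernible (dotxx Rid a)); apply: der => [d Dd|x].
- by apply: prE => x dx; apply: vD; exists d.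
- by rewrite /pr; case: asboolP => [ax|_] y /= ->.
Qed.

End Completeness.

Theorem theorem4p9 (Lg : language) (L : consequence Lg) (p : form Lg)
    (H : calculus Lg) :
  is_logic L -> partition_function L p -> determines H L ->
  determines (left_calculus p H) (left_companion L).
Proof.
move=> logL pfp detL G a; split=> [[D [DG vD /detL Da]]|].
  by apply: (left_calculus_complete (pf_vars pfp)); exists D.
exact: left_calculus_sound logL pfp detL G a.
Qed.
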